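(* Suppose that the latent pairs $(X_1,\mathbb Q_1),\ldots,(X_{n+1},\mathbb Q_{n+1})$ are exchangeable and that, conditional on these pairs, the outcomes $Y_1,\ldots,Y_{n+1}$ are independent with $Y_i\sim\mathbb Q_i$. Let $\alpha\in(0,1)$, let $\Gamma\subset(0,\alpha)$ be a (Borel) set of miscoverage levels, and let $\nu$ be a probability measure supported on $\Gamma$ which is fixed independently of the calibration sample $\mathcal D_n=(X_i,Y_i)_{i=1}^n$ and of the future instance $(X_{n+1},\mathbb Q_{n+1},Y_{n+1})$. Then the conformalized ambiguity set $\mathfrak U_\alpha^\nu$ satisfies $$\mathbb P\left\{\mathbb Q_{n+1}\in\mathfrak U_\alpha^\nu(X_{n+1})\right\}\ge 1-\alpha .$$
   Context: Setting. $\mathcal X$ and $\mathcal Y$ are standard Borel spaces, and $\mathcal P(\mathcal Y)$ is the set of probability measures on $\mathcal Y$. For each instance $i=1,\ldots,n+1$, $X_i$ is an $\mathcal X$-valued context, $\mathbb Q_i$ is an unobserved random element of $\mathcal P(\mathcal Y)$ (the latent conditional law) with $\mathbb Q_i\mid X_i\sim\pi(\cdot\mid X_i)$ for an unknown mixing kernel $\pi$, and $Y_i$ is a $\mathcal Y$-valued outcome with $Y_i\mid(X_i,\mathbb Q_i)\sim\mathbb Q_i$. Split conformal sets. $s:\mathcal X\times\mathcal Y\to\mathbb R$ is a measurable nonconformity score built from a predictor trained on data independent of the calibration data and the next instance; it is treated as a fixed function. Put $S_i=s(X_i,Y_i)$. For $\gamma\in(0,1)$ let $k_\gamma=\lceil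 (n+1)(1-\gamma)\rceil$ and let $\widehat q_{1-\gamma}$ be the $k_\gamma$-th order statistic (the $k_\gamma$-th smallest value) of $S_1,\ldots,S_n$, with $\widehat q_{1-\gamma}=+\infty$ when $k_\gamma=n+1$. The conformal set is $$\mathcal C_\gamma(x)=\mathcal C_\gamma(x;\mathcal D_n)=\{y\in\mathcal Y: s(x,y)\le\widehat q_{1-\gamma}\}.$$ Ambiguity set. For $\mathbb Q\in\mathcal P(\mathcal Y)$ define $$q_\gamma(\mathbb Q;x)=\frac{1-\mathbb Q(\mathcal C_\gamma(x))}{\gamma},\qquad e_\nu(\mathbb Q;x)=\int_\Gamma q_\gamma(\mathbb Q;x)\,\nu(\mathrm d\gamma),$$ $$\mathfrak U_\alpha^\nu(x)=\left\{\mathbb Q\in\mathcal P(\mathcal Y): e_\nu(\mathbb Q;x)\le \frac1\alpha\right\}.$$ The probability in the claim is over the calibration data, the context $X_{n+1}$ and the latent law $\mathbb Q_{n+1}$. *)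

(* Defs.v *)
From mathcomp Require Import all_boot all_order all_algebra.
From mathcomp Require Import perm.
From mathcomp Require Import all_classical all_reals all_analysis measurable_realfun.

Set Implicit Arguments.
Unset Strict Implicit.
Unset Printing Implicit Defensive.

Import Order.TTheory GRing.Theory Num.Theory.
Import numFieldNormedType.Exports.

Local Open Scope classical_set_scope.
Local Open Scope ring_scope.
Local Open Scope ereal_scope.

(* T is isomorphic, as a measurable space, to a separable complete metric space
   M with its Borel sigma-algebra. A pseudometric is a metric exactly when its
   topology is Hausdorff. *)
Definition standard_borel (R : realType) d (T : measurableType d) : Prop :=
  exists (M : completePseudoMetricType R) (f : T -> M),
    [/\ hausdorff_space M,
        exists2 D : set M, countable D & dense D,
        bijective f
      & forall A : set T, measurable A <-> <<s @open M >> (f @` A)].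

Section conditioning.
Context d (Omega : measurableType d) (R : realType) (P : probability Omega R).

(* g is a version of z |-> P(E | Z = z), that is, g \o Z is a version of the
   conditional probability of E given the sigma-algebra generated by Z. *)
Definition cond_prob d' (T : measurableType d') (Z : Omega -> T)
    (E : set Omega) (g : T -> \bar R) : Prop :=
  measurable_fun [set: T] g /\
  forall A : set T, measurable A ->
    P (Z @^-1` A `&` E) = \int[P]_(w in Z @^-1` A) g (Z w).

Definition cond_law d1 d2 (T : measurableType d1) (U : measurableType d2)
    (Z : Omega -> T) (W : Omega -> U) (kappa : T -> set U -> \bar R) : Prop :=
  forall B : set U, measurable B ->
    cond_prob Z (W @^-1` B) (fun z => kappa z B).

(* Given Z, the W i are independent with respective laws kappa i. The marginal
   laws are the instances in which all but one of the B j are the full space. *)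
Definition cond_indep_laws d1 d2 (T : measurableType d1)
    (U : measurableType d2) (m : nat) (Z : Omega -> T) (W : 'I_m -> Omega -> U)
    (kappa : 'I_m -> T -> set U -> \bar R) : Prop :=
  forall B : 'I_m -> set U, (forall i, measurable (B i)) ->
    cond_prob Z (\bigcap_i (W i @^-1` B i))
              (fun z => \prod_(i < m) kappa i z (B i)).

Definition exchangeable d' (T : measurableType d') (m : nat)
    (Z : 'I_m -> Omega -> T) : Prop :=
  forall (sigma : {perm 'I_m}) (A : set (m.-tuple T)), measurable A ->
    P [set w | A [tuple Z (sigma i) w | i < m]] =
    P [set w | A [tuple Z i w | i < m]].

End conditioning.

Section conformal.
Context (R : realType) d1 d2 (XT : measurableType d1) (YT : measurableType d2).

(* The absolute value only converts from int to nat: for 0 < gamma < 1 the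
   ceiling lies between 1 and n + 1. *)
Definition conformal_rank (n : nat) (gamma : R) : nat :=
  `|Num.ceil ((n.+1)%:R * (1 - gamma)%R)|%N.

(* nth counts from 0, so the k-th smallest value has index k - 1. *)
Definition conformal_quantile (n : nat) (S : 'I_n -> R) (gamma : R) : \bar R :=
  let k := conformal_rank n gamma in
  if k == n.+1 then +oo
  else (nth 0%R (sort <=%R [seq S i | i : 'I_n]) k.-1)%:E.

Definition conformal_set (s : XT * YT -> R) (n : nat) (D : 'I_n -> XT * YT)
    (gamma : R) (x : XT) : set YT :=
  [set y | (s (x, y))%:E <= conformal_quantile (fun i => s (D i)) gamma].

Definition miscoverage_ratio (s : XT * YT -> R) (n : nat) (D : 'I_n -> XT * YT)
    (gamma : R) (Q : probability YT R) (x : XT) : \bar R :=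
  (1 - Q (conformal_set s D gamma x)) * (gamma^-1)%:E.

Definition mixed_evalue (s : XT * YT -> R) (n : nat) (D : 'I_n -> XT * YT)
    (Gamma : set R) (nu : probability R R) (Q : probability YT R) (x : XT)
    : \bar R :=
  \int[nu]_(gamma in Gamma) miscoverage_ratio s D gamma Q x.

Definition ambiguity_set (s : XT * YT -> R) (n : nat) (D : 'I_n -> XT * YT)
    (Gamma : set R) (nu : probability R R) (alpha : R) (x : XT)
    : set (probability YT R) :=
  [set Q | mixed_evalue s D Gamma nu Q x <= (alpha^-1)%:E].

End conformal.

(* Main.v *)
Require Import Defs.
From mathcomp Require Import all_boot all_order all_algebra.
From mathcomp Require Import perm.
From mathcomp Require Import all_classical all_reals all_analysis measurable_realfun.

Set Implicit Arguments.
Unset Strict Implicit.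
Unset Printing Implicit Defensive.

Import Order.TTheory GRing.Theory Num.Theory.
Import numFieldNormedType.Exports.

Local Open Scope classical_set_scope.
Local Open Scope ring_scope.
Local Open Scope ereal_scope.

(** Let S_i be the score of instance i. A candidate outcome y of the last
    instance lies outside the conformal set at level gamma exactly when at least
    (n + 1)(1 - gamma) of the calibration scores are strictly below the score of
    y ([conformal_setC]). In this form the set depends measurably on all data
    jointly, without any order statistic.

    The probability, under the latent law Q of the last instance, of falling
    outside the conformal set is the probability that a fresh draw from Q has
    a score of such a high rank. Since the actual outcome is a draw from Q that is
    independent of the other outcomes given the latent variables, redrawing it
    does not change the joint law ([resample_law]). Hence the expected latent
    miscoverage is the probability that the actual last score has high rank. The
    pairs of a latent variable and an outcome are exchangeable because the latent
    variables are ([exchangeable_outcomes]), and at most (n + 1) gamma scores can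
    have such a high rank at once ([card_high_ranks]); so that probability is at
    most gamma ([average_miscoverage]).

    Dividing by gamma and integrating against nu, Tonelli's theorem bounds the
    expectation of the mixed e-value by one ([average_evalue]), and Markov's
    inequality at the threshold 1 / alpha gives the claim ([markov_threshold]).

    Both facts about joint laws are equalities of finite measures on tuples of
    pairs. They are checked on boxes, which form a generating pi-system
    ([box_measure_unique]); there the conditional independence gives explicit
    products. *)

(** * Laws on finite products *)

Lemma measurable_rect d (T : measurableType d) (m : nat) (A : 'I_m -> set T) :
  (forall i, measurable (A i)) ->
  measurable [set t : m.-tuple T | forall i, A i (tnth t i)].
Proof.
move=> mA.
rewrite [X in measurable X](_ : _ = \bigcap_i ((@tnth m _)^~ i @^-1` A i)).
  apply: fin_bigcap_measurable => // i _; rewrite -[X in measurable X]setTI.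
  exact: measurable_tnth.
by apply/seteqP; split => t /= H i; [move=> _|]; exact: H.
Qed.

Lemma measurable_mktuple d' (T : measurableType d') d0 (U : measurableType d0)
    (k : nat) (f : 'I_k -> U -> T) : (forall i, measurable_fun setT (f i)) ->
  measurable_fun setT (fun w => [tuple f i w | i < k]).
Proof.
move=> mf; apply/measurable_fun_tnthP => i.
by apply: eq_measurable_fun (mf i) => w _ /=; rewrite tnth_mktuple.
Qed.

Lemma mktuple_perm1 (U T : Type) (m : nat) (f : 'I_m -> U -> T) :
  (fun u => [tuple f ((1%g : {perm 'I_m}) i) u | i < m]) =
  (fun u => [tuple f i u | i < m]).
Proof. by apply/funext => u; apply: eq_mktuple => i; rewrite perm1. Qed.

Section box_unique.
Context d1 d2 (T1 : measurableType d1) (T2 : measurableType d2) (m : nat).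

Definition box (A : 'I_m -> set T1) (B : 'I_m -> set T2)
    : set (m.-tuple (T1 * T2)) :=
  [set t | forall i, A i (tnth t i).1 /\ B i (tnth t i).2].

Let boxes : set (set (m.-tuple (T1 * T2))) :=
  [set E | exists A B, [/\ forall i, measurable (A i),
     forall i, measurable (B i) & E = box A B]].

Lemma measurable_box A B : (forall i, measurable (A i)) ->
  (forall i, measurable (B i)) -> measurable (box A B).
Proof.
by move=> mA mB; apply: (@measurable_rect _ _ m (fun i => A i `*` B i)) => i;
  exact: measurableX.
Qed.

(** A coordinate map is measurable for the sigma-algebra of the boxes because
    the preimage of a rectangle is a box all of whose other sides are full. *)
Lemma measurable_tuple_boxes :
  (@measurable _ (m.-tuple (T1 * T2)) : set (set _)) = <<s boxes >>.
Proof.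
apply/seteqP; split; last first.
  apply: smallest_sub; first exact: sigma_algebra_measurable.
  by move=> _ [A [B [mA mB ->]]]; exact: measurable_box.
have tnth_boxes i :
    measurable_fun [set: g_sigma_algebraType boxes] (@tnth m (T1 * T2)^~ i).
  apply: (measurability _ (measurable_prod_measurableType _ _)).
  move=> _ [_ [A mA [B mB <-]] <-]; rewrite setTI.
  apply: sub_sigma_algebra => /=.
  exists (fun k => if k == i then A else setT).
  exists (fun k => if k == i then B else setT).
  split => [k|k|]; [by case: ifP|by case: ifP|].
  apply/seteqP; split => [t /= [At Bt] k|t /=/(_ i)]; last by rewrite eqxx.
  by have [->|] := eqVneq k i.
move=> E mE.
have /= := @measurable_fun_tnthP _ _ (g_sigma_algebraType boxes) _ m id.
by case=> _ /(_ tnth_boxes) /(_ measurableT _ mE); rewrite setTI.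
Qed.

Lemma box_measure_unique (R : realType)
    (mu nu : {measure set (m.-tuple (T1 * T2)) -> \bar R}) :
  mu setT < +oo ->
  (forall A B, (forall i, measurable (A i)) -> (forall i, measurable (B i)) ->
    mu (box A B) = nu (box A B)) ->
  forall E, measurable E -> mu E = nu E.
Proof.
move=> mufin munu; apply: (measure_unique boxes (fun=> setT)).
- exact: measurable_tuple_boxes.
- move=> _ _ [A [B [mA mB ->]]] [A' [B' [mA' mB' ->]]].
  exists (fun i => A i `&` A' i), (fun i => B i `&` B' i); split => [i|i|].
  + exact: measurableI.
  + exact: measurableI.
  + apply/seteqP; split => [t [H H'] i|t H].
      by have [? ?] := H i; have [? ?] := H' i.
    by split => i; have [[? ?] [? ?]] := H i.
- move=> _; exists (fun=> setT), (fun=> setT); split => //.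
  by apply/seteqP; split.
- by rewrite bigcup_const.
- by move=> _ [A [B [mA mB ->]]]; exact: munu.
- by [].
Qed.

End box_unique.

(** The two random elements may live on different spaces: this is what allows
    the comparison of the sample with a sample whose outcome is redrawn. *)
Lemma box_pushforward_unique d1 d2 (T1 : measurableType d1)
    (T2 : measurableType d2) (m : nat) dU dV (U : measurableType dU)
    (V : measurableType dV) (R : realType)
    (mu : {measure set U -> \bar R}) (nu : {measure set V -> \bar R})
    (f : U -> m.-tuple (T1 * T2)) (g : V -> m.-tuple (T1 * T2)) :
  measurable_fun setT f -> measurable_fun setT g -> mu setT < +oo ->
  (forall A B, (forall i, measurable (A i)) -> (forall i, measurable (B i)) ->
    mu (f @^-1` box A B) = nu (g @^-1` box A B)) ->
  forall E, measurable E -> mu (f @^-1` E) = nu (g @^-1` E).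
Proof.
move=> mf mg fin fg E mE.
by apply: (@box_measure_unique _ _ _ _ m R (pushforward mu f)
  (pushforward nu g)).
Qed.

(** * Conditional probabilities as densities *)

Section conditioning.
Context d (Omega : measurableType d) (R : realType) (P : probability Omega R).

Import HBNNSimple.

(** The defining identity of a conditional probability is the case where [h] is
    the indicator of a measurable set; simple functions and monotone
    convergence do the rest. Finiteness of [g] makes multiplication by [g]
    continuous along the approximation. *)
Lemma cond_prob_integral d' (T : measurableType d') (Z : Omega -> T)
    (E : set Omega) (g h : T -> \bar R) :
  measurable_fun setT Z -> measurable E -> cond_prob P Z E g ->
  (forall z, 0 <= g z) -> (forall z, g z \is a fin_num) ->
  measurable_fun setT h -> (forall z, 0 <= h z) ->
  \int[P]_(w in E) h (Z w) = \int[P]_w (h (Z w) * g (Z w)).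
Proof.
move=> mZ mE [mg gE] g0 gfin mh h0.
pose f := nnsfun_approx measurableT mh.
have mf n : measurable_fun setT (fun w => (f n (Z w))%:E).
  by apply/measurable_EFinP/measurableT_comp.
have mgZ : measurable_fun setT (fun w => g (Z w)) by exact: measurableT_comp.
have fh z : (f n z)%:E @[n --> \oo] --> h z by exact: cvg_nnsfun_approx.
have fnd z a b : (a <= b)%N -> (f a z)%:E <= (f b z)%:E.
  by move=> ab; rewrite lee_fin; exact/lefP/nd_nnsfun_approx.
transitivity (lim (\int[P]_(w in E) (f n (Z w))%:E @[n --> \oo])).
  rewrite -monotone_convergence//.
  - by apply: eq_integral => w _; apply/esym/cvg_lim.
  - by move=> n; exact: measurable_funTS.
  - by move=> n w _; rewrite lee_fin.
  - by move=> w _ a b; exact: fnd.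
transitivity (lim (\int[P]_w ((f n (Z w))%:E * g (Z w)) @[n --> \oo])); last first.
  rewrite -monotone_convergence//.
  - apply: eq_integral => w _; apply/cvg_lim => //.
    by apply: cvgeZr; [exact: gfin|exact: fh].
  - by move=> n; exact: emeasurable_funM.
  - by move=> n w _; rewrite mule_ge0// lee_fin.
  - by move=> w _ a b ab; rewrite lee_wpmul2r//; exact: fnd.
congr (lim (_ @ \oo)); apply/funext => n.
pose A r := f n @^-1` [set r].
have mA r : measurable (A r) by exact: measurable_funPTI.
have mZA r : measurable (Z @^-1` A r).
  by rewrite -[X in measurable X]setTI; apply: mZ.
have mind r : measurable_fun setT (fun w => (r * \1_(A r) (Z w))%:E).
  by apply/measurable_EFinP; apply: measurable_funM => //; exact: measurableT_comp.
have fE w : (f n (Z w))%:E = \sum_(r \in range (f n)) (r * \1_(A r) (Z w))%:E.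
  by rewrite fimfunE fsumEFin.
under eq_integral do rewrite fE.
under [RHS]eq_integral => w _.
  rewrite fE ge0_mule_fsuml; last by move=> r; exact: nnfun_muleindic_ge0.
  over.
rewrite ge0_integral_fsum//; last 2 first.
  by move=> r; exact: measurable_funTS.
  by move=> r w _; exact: nnfun_muleindic_ge0.
rewrite ge0_integral_fsum//; last 2 first.
  by move=> r; exact: emeasurable_funM.
  by move=> r w _; rewrite mule_ge0//; exact: nnfun_muleindic_ge0.
apply: eq_fsbigr => r /[!inE] -[z _ fz].
have r0 : (0 <= r)%R by rewrite -fz.
under eq_integral do rewrite EFinM.
under [RHS]eq_integral do rewrite EFinM -muleA.
rewrite ge0_integralZl//; last first.
  apply: measurable_funTS; apply/measurable_EFinP.
  by apply: measurableT_comp => //; exact: measurable_indic.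
rewrite ge0_integralZl//; last 2 first.
  - apply: emeasurable_funM => //; apply/measurable_EFinP.
    by apply: measurableT_comp => //; exact: measurable_indic.
  - by move=> w _; rewrite mule_ge0// lee_fin.
congr (_ * _).
rewrite (integral_indic P mE (mZA r)) [LHS](gE _ (mA r)).
rewrite [LHS]integral_mkcond; apply: eq_integral => w _.
rewrite patchE [\1_(A r) (Z w)]indicE (_ : (Z w \in A r) = (w \in Z @^-1` A r))//.
by case: ifPn; rewrite ?mul1e ?mul0e.
Qed.

End conditioning.

(** * Outcomes drawn independently given the latent variables *)

Section conditionally_independent_outcomes.
Context d d1 d2 (Omega : measurableType d) (T1 : measurableType d1)
  (T2 : measurableType d2) (R : realType) (P : probability Omega R) (m : nat).
Variables (Z : 'I_m -> Omega -> T1) (Y : 'I_m -> Omega -> T2).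
Variable q : T1 -> pprobability T2 R.
Hypothesis mZ : forall i, measurable_fun setT (Z i).
Hypothesis mY : forall i, measurable_fun setT (Y i).
Hypothesis mq : measurable_fun setT q.
Hypothesis YZ : cond_indep_laws P (fun w => [tuple Z i w | i < m]) Y
  (fun i z B => q (tnth z i) B).

Let ZY i w := (Z i w, Y i w).

Let mZY i : measurable_fun setT (ZY i).
Proof. exact: measurable_fun_pair. Qed.

Lemma measurable_eval B : measurable B -> measurable_fun setT (fun z => q z B).
Proof. exact: (@measurable_kernel _ _ _ _ _ (kprobability mq)). Qed.

Lemma prob_box_outcomes (A : 'I_m -> set T1) (B : 'I_m -> set T2) :
  (forall i, measurable (A i)) -> (forall i, measurable (B i)) ->
  P [set w | forall i, A i (Z i w) /\ B i (Y i w)] =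
  \int[P]_(w in [set w | forall i, A i (Z i w)]) \prod_(i < m) q (Z i w) (B i).
Proof.
move=> mA mB.
pose A' : set (m.-tuple T1) := [set z | forall i, A i (tnth z i)].
have mA' : measurable A' by exact: measurable_rect.
have [_ /(_ _ mA')] := YZ mB.
rewrite (_ : _ @^-1` A' = [set w | forall i, A i (Z i w)]); last first.
  by apply/seteqP; split => w /= H i; have := H i; rewrite tnth_mktuple.
rewrite (_ : _ `&` _ = [set w | forall i, A i (Z i w) /\ B i (Y i w)]).
  move=> ->; apply: eq_integral => w _; apply: eq_bigr => i _.
  by rewrite tnth_mktuple.
apply/seteqP; split => [w /= [H K] i|w /= H].
  by split; [exact: H|exact: K].
by split => i; [|move=> _]; have [] := H i.
Qed.

(** On a box the joint law is the integral, against the law of the latent tuple,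
    of the product of the conditional probabilities of the sides. Permuting the
    instances permutes the factors of that product, so it amounts to permuting
    the latent tuple alone. *)
Lemma exchangeable_outcomes : exchangeable P Z -> exchangeable P ZY.
Proof.
move=> exZ sigma.
apply: (@box_pushforward_unique _ _ _ _ m _ _ _ _ R P P).
- by apply: measurable_mktuple => i; exact: mZY.
- by apply: measurable_mktuple => i; exact: mZY.
- exact: le_lt_trans (probability_le1 P measurableT) (ltry _).
move=> A B mA mB.
pose F (z : m.-tuple T1) : \bar R := \prod_(i < m) q (tnth z i) (B i).
pose A' : set (m.-tuple T1) := [set z | forall i, A i (tnth z i)].
have mA' : measurable A' by exact: measurable_rect.
have mF : measurable_fun setT F by have [] := YZ mB.
have F0 z : 0 <= F z by apply: prode_ge0 => i _; exact: measure_ge0.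
(* The permutation is moved from the instances to the sides of the box, which
   is the form to which the conditional independence applies. *)
have law (tau : {perm 'I_m}) :
    P ((fun w => [tuple ZY (tau i) w | i < m]) @^-1` box A B) =
    \int[pushforward P (fun w => [tuple Z (tau i) w | i < m])]_(z in A') F z.
  rewrite ge0_integral_pushforward//.
  - rewrite (_ : _ @^-1` box A B = [set w | forall i,
        A (tau^-1%g i) (Z i w) /\ B (tau^-1%g i) (Y i w)]); last first.
      apply/seteqP; split => w /= H i.
        by have := H (tau^-1%g i); rewrite tnth_mktuple permKV.
      by have := H (tau i); rewrite tnth_mktuple permK.
    rewrite [LHS](@prob_box_outcomes (fun i => A (tau^-1%g i))
      (fun i => B (tau^-1%g i)))//.
    rewrite (_ : _ @^-1` A' = [set w | forall i, A (tau^-1%g i) (Z i w)]).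
      apply: eq_integral => w _; rewrite /F /= (reindex_perm tau).
      by apply: eq_bigr => i _; rewrite permK tnth_mktuple.
    apply/seteqP; split => w /= H i.
      by have := H (tau^-1%g i); rewrite tnth_mktuple permKV.
    by have := H (tau i); rewrite tnth_mktuple permK.
  - by apply: measurable_mktuple => i; exact: mZ.
  - exact: measurable_funTS.
have := law 1%g; rewrite (mktuple_perm1 ZY) => law1; rewrite [LHS]law [RHS]law1.
have mZtau (tau : {perm 'I_m}) :
    measurable_fun setT (fun w => [tuple Z (tau i) w | i < m]).
  by apply: measurable_mktuple => i; exact: mZ.
apply: eq_measure_integral => S mS _.
by rewrite /= /pushforward (mktuple_perm1 Z); exact: exZ.
Qed.

Definition resample (j : 'I_m) (w : Omega) (y : T2) : m.-tuple (T1 * T2) :=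
  [tuple (Z i w, if i == j then y else Y i w) | i < m].

Lemma measurable_resample j :
  measurable_fun setT (fun wy => resample j wy.1 wy.2).
Proof.
apply: measurable_mktuple => i; apply: measurable_fun_pair.
  exact: measurableT_comp.
by case: (i == j); [exact: measurable_snd|exact: measurableT_comp].
Qed.

(** Redrawing outcome [j] from its own conditional law, independently of
    everything else given the latent variables, leaves the joint law unchanged.
    This turns the latent mass of a data-dependent set into the probability
    that the actual outcome falls into that set. *)
Lemma resample_law j E : measurable E ->
  \int[P]_w q (Z j w) (resample j w @^-1` E) =
  P [set w | E [tuple ZY i w | i < m]].
Proof.
move=> mE.
have mPcst : measurable_fun setT (fun _ : unit => P : pprobability Omega R).
  exact: measurable_cst.
have mqZ : measurable_fun setT (fun uw : unit * Omega => q (Z j uw.2)).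
  by apply: measurableT_comp => //; exact: measurableT_comp.
(* The law of (w, y) with w drawn from P and then y from q (Z j w), obtained as
   a product of kernels with the one-point source space. *)
pose PQ := mkproduct (kprobability mPcst) (kprobability mqZ) tt.
have PQE (S : set (Omega * T2)) : measurable S ->
    PQ S = \int[P]_w q (Z j w) (xsection S w).
  by move=> mS; apply: eq_integral => w _; rewrite kernel.intker_indicE.
transitivity (PQ ((fun wy => resample j wy.1 wy.2) @^-1` E)).
  rewrite PQE; last first.
    by rewrite -[X in measurable X]setTI; exact: (measurable_resample j).
  by apply: eq_integral => w _; rewrite xsectionE.
apply/esym; apply: (@box_pushforward_unique _ _ _ _ m _ _ _ _ R P PQ) => //.
- by apply: measurable_mktuple => i; exact: mZY.
- exact: measurable_resample.
- exact: le_lt_trans (probability_le1 P measurableT) (ltry _).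
move=> A B mA mB.
pose A' : set (m.-tuple T1) := [set z | forall i, A i (tnth z i)].
have mA' : measurable A' by exact: measurable_rect.
pose Zt w := [tuple Z i w | i < m].
have mZt : measurable_fun setT Zt.
  by apply: measurable_mktuple => i; exact: mZ.
have ZtA w : A' (Zt w) <-> forall i, A i (Z i w).
  by split => H i; have := H i; rewrite tnth_mktuple.
(* The original outcome j is unconstrained once it has been redrawn. *)
pose B' i := if i == j then setT else B i.
have mB' i : measurable (B' i) by rewrite /B'; case: ifP.
pose g (z : m.-tuple T1) : \bar R := \prod_(i < m) q (tnth z i) (B' i).
pose h := (fun z : m.-tuple T1 => q (tnth z j) (B j)) \_ A'.
pose C := \bigcap_i (Y i @^-1` B' i).
have mC : measurable C.
  apply: fin_bigcap_measurable => // i _; rewrite -[X in measurable X]setTI.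
  exact: mY.
have h0 z : 0 <= h z by rewrite /h patchE; case: ifP.
have mh : measurable_fun setT h.
  apply/(measurable_restrictT _ _).1 => //; apply: measurable_funTS.
  exact: measurableT_comp (measurable_eval (mB j)) (measurable_tnth j).
have hgE : \int[P]_(w in C) h (Zt w) = \int[P]_w (h (Zt w) * g (Zt w)).
  apply: cond_prob_integral => //; first exact: YZ.
  - by move=> z; apply: prode_ge0 => i _; exact: measure_ge0.
  - by move=> z; apply: prode_fin_num => i _; exact: fin_num_measure.
transitivity (\int[P]_w (h (Zt w) * g (Zt w))).
  rewrite [LHS](_ : _ =
    P [set w | forall i, A i (Z i w) /\ B i (Y i w)]); last first.
    congr (P _); apply/seteqP; split => w /= H i.
      by have := H i; rewrite tnth_mktuple.
    by rewrite tnth_mktuple.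
  rewrite prob_box_outcomes// integral_mkcond; apply: eq_integral => w _.
  rewrite /h !patchE.
  have -> : (w \in [set w | forall i, A i (Z i w)]) = (Zt w \in A').
    by apply: asbool_equiv_eq; exact: iff_sym (ZtA w).
  case: ifP => _; last by rewrite mul0e.
  rewrite /g (bigD1 j)//= [in RHS](bigD1 j)//= tnth_mktuple /B' eqxx.
  rewrite probability_setT mul1e; congr (_ * _).
  by apply: eq_bigr => i /negPf ij; rewrite ij tnth_mktuple.
rewrite -hgE PQE; last first.
  rewrite -[X in measurable X]setTI; apply: (measurable_resample j) => //.
  exact: measurable_box.
rewrite integral_mkcond; apply: eq_integral => w _.
rewrite /h !patchE xsectionE.
case: ifPn => [/set_mem Cw|nCw]; last first.
  rewrite (_ : _ @^-1` _ = set0) ?measure0//.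
  apply/seteqP; split => // y /= H; move/negP: nCw; apply; apply/mem_set => i _.
  rewrite /= /B'; case: ifPn => // ij.
  by have [_] := H i; rewrite tnth_mktuple /= (negbTE ij).
case: ifPn => [/set_mem/ZtA Aw|nAw]; last first.
  rewrite (_ : _ @^-1` _ = set0) ?measure0//.
  apply/seteqP; split => // y /= H; move/negP: nAw; apply; apply/mem_set/ZtA => i.
  by have [+ _] := H i; rewrite tnth_mktuple.
rewrite tnth_mktuple; congr (q _ _); apply/seteqP; split => y /=; last first.
  by move=> /(_ j)[_]; rewrite tnth_mktuple /= eqxx.
move=> By i; rewrite tnth_mktuple /=; split; first exact: Aw.
by have := Cw i I; rewrite /= /B'; case: eqP => [->|].
Qed.

End conditionally_independent_outcomes.

(** * Ranks and the conformal quantile *)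

Definition count_below (R : realType) (m : nat) (S : 'I_m -> R) (v : R) : nat :=
  #|[pred i | (S i < v)%R]|.

Section ranks.
Context (R : realType).
Local Open Scope ring_scope.

Lemma count_belowE (m : nat) (S : 'I_m -> R) (v : R) :
  (count_below S v)%:R = \sum_(i < m) (S i < v)%R%:R :> R.
Proof.
rewrite /count_below -sum1_card natr_sum big_mkcond /=.
by apply: eq_bigr => i _; rewrite inE; case: ifP.
Qed.

(** Take the smallest score of high rank: at least [x] scores lie strictly below
    it, and none of those has high rank. Ties cause no trouble because only
    strictly smaller scores are counted. *)
Lemma card_high_ranks (m : nat) (S : 'I_m -> R) (x : R) : x <= m%:R ->
  #|[pred j | x <= (count_below S (S j))%:R]|%:R <= m%:R - x.
Proof.
move=> xm; set J := [pred j | _].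
have [j1 Jj1|J0] := pickP J; last by rewrite (eq_card0 J0) subr_ge0.
case: (arg_minP S Jj1) => j0 Jj0 j0_min.
rewrite lerBrDr (@le_trans _ _ (#|J|%:R + (count_below S (S j0))%:R))//.
  by rewrite lerD2l; exact: Jj0.
rewrite -natrD ler_nat -[leqRHS]card_ord -cardUI.
rewrite [X in (_ + X)%N]eq_card0 ?addn0 ?max_card// => i.
rewrite !inE; apply/negbTE/andP => -[Ji]; rewrite ltNge => /negP; apply.
exact: j0_min.
Qed.

(** In the sorted sequence the values at least [v] form the segment that starts
    at the index given by the number of values below [v]. *)
Lemma sort_nth_lt (s : seq R) (k : nat) (v : R) : (k < size s)%N ->
  (nth 0 (sort <=%R s) k < v) = (k < count (< v)%R s)%N.
Proof.
move=> ks; have ss : sorted <=%R (sort <=%R s) by exact: sort_le_sorted.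
rewrite -(seq.permP (permEl (perm_sort <=%R s))).
apply/idP/idP; last exact: nth_count_lt.
move=> lt; rewrite ltnNge; apply/negP => ck.
have := sorted_filter_ge v ss.
move=> /(congr1 (fun t => nth 0 t (k - count (< v)%O (sort <=%R s)))).
rewrite nth_drop subnKC// => E.
have : v <= nth 0 (sort <=%R s) k.
  rewrite -E; apply: (allP (filter_all (fun y => v <= y) (sort <=%R s))).
  rewrite mem_nth// sorted_filter_ge// size_drop size_sort.
  by rewrite ltn_sub2r// (leq_ltn_trans ck).
by rewrite leNgt lt.
Qed.

(** Exceeding the conformal quantile is a condition on a rank. The ceiling
    disappears because it is compared with an integer, and the infinite quantile
    fits the formula because at most [n] scores lie below [v]. *)
Lemma conformal_quantile_lt (n : nat) (S : 'I_n -> R) (gamma v : R) :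
  0 < gamma < 1 ->
  (conformal_quantile S gamma < v%:E)%E =
  (n.+1%:R * (1 - gamma) <= (count_below S v)%:R).
Proof.
move=> /andP[g0 g1]; rewrite /conformal_quantile.
set x := n.+1%:R * (1 - gamma).
have x0 : 0 < x by rewrite mulr_gt0 ?ltr0n// subr_gt0.
have xn : x <= n.+1%:R by rewrite ler_piMr ?ler0n// lerBlDr lerDl ltW.
have rank_le (c : nat) : (conformal_rank n gamma <= c)%N = (x <= c%:R).
  have c0 : 0 <= Num.ceil x by rewrite ceil_ge0 (lt_trans _ x0)// ltrN10.
  rewrite /conformal_rank -/x -lez_nat gez0_abs//.
  by rewrite ceil_le_int.
have rank_gt0 : (0 < conformal_rank n gamma)%N.
  by rewrite ltnNge rank_le -ltNge.
rewrite -rank_le; case: ifPn => [/eqP ->|kn].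
  rewrite ltNge leey /=; apply/esym/negbTE; rewrite -ltnNge ltnS.
  by rewrite -[leqRHS]card_ord max_card.
have kn' : (conformal_rank n gamma <= n)%N.
  by rewrite -ltnS ltn_neqAle kn rank_le.
rewrite lte_fin sort_nth_lt; last by rewrite size_map size_enum_ord prednK.
rewrite prednK// count_map; congr (_ <= _)%N.
by rewrite /count_below cardE -size_filter enumT.
Qed.

End ranks.

Lemma conformal_setC (R : realType) d1 d2 (XT : measurableType d1)
    (YT : measurableType d2) (s : XT * YT -> R) (n : nat)
    (D : 'I_n -> XT * YT) (gamma : R) (x : XT) : (0 < gamma < 1)%R ->
  ~` conformal_set s D gamma x =
  [set y | (n.+1%:R * (1 - gamma) <=
            (count_below (fun i => s (D i)) (s (x, y)))%:R)%R].
Proof.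
move=> g01; apply/funext => y; rewrite /setC /conformal_set /=.
rewrite -(conformal_quantile_lt _ _ g01); apply/propext.
by rewrite ltNge; split => /negP.
Qed.

Section high_rank.
Context d (T : measurableType d) (R : realType) (m : nat) (S : T -> R).
Hypothesis mS : measurable_fun setT S.

Definition high_rank (x : R) (j : 'I_m) : set (m.-tuple T) :=
  [set t | (x <= (count_below (fun i => S (tnth t i)) (S (tnth t j)))%:R)%R].

Lemma measurable_high_rank d' (U : measurableType d') (t : U -> m.-tuple T)
    (x : U -> R) (j : 'I_m) :
  measurable_fun setT t -> measurable_fun setT x ->
  measurable [set u | high_rank (x u) j (t u)].
Proof.
move=> mt mx; rewrite /high_rank /=.
under eq_set do rewrite count_belowE.
have mSt i : measurable_fun setT (fun u => S (tnth (t u) i)).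
  apply: measurableT_comp => //.
  exact: (measurableT_comp (measurable_tnth i) mt).
rewrite -[X in measurable X]setTI.
apply: (measurable_fun_ler mx _ measurableT (Y := [set true])) => //.
apply: measurable_sum => i.
have -> : (fun u => (S (tnth (t u) i) < S (tnth (t u) j))%R%:R) =
  (fun u => if (S (tnth (t u) i) < S (tnth (t u) j))%R then 1%R else 0%R : R).
  by apply/funext => u; case: ifP.
by apply: measurable_fun_ifT => //; exact: measurable_fun_ltr.
Qed.

(** Exchangeability makes the probability that instance [j] has high rank
    independent of [j], and at most [m - x] instances have high rank at the same
    time. *)
Lemma exchangeable_high_rank d' (Omega : measurableType d')
    (P : probability Omega R) (V : 'I_m -> Omega -> T) (x : R) (j : 'I_m) :
  (forall i, measurable_fun setT (V i)) -> exchangeable P V -> (x <= m%:R)%R ->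
  m%:R%:E * P [set w | high_rank x j [tuple V i w | i < m]] <= (m%:R - x)%:E.
Proof.
move=> mV exV xm.
pose E k := [set w | high_rank x k [tuple V i w | i < m]].
have mhr k : measurable (high_rank x k).
  by apply: (measurable_high_rank (t := id) (x := cst x)).
have mE k : measurable (E k).
  apply: (measurable_high_rank (x := cst x)) => //.
  by apply: measurable_mktuple => i; exact: mV.
have high_rankV (tau : {perm 'I_m}) k w :
    high_rank x k [tuple V (tau i) w | i < m] =
    (x <= (count_below (fun i => S (V i w)) (S (V (tau k) w)))%:R)%R :> Prop.
  rewrite /high_rank /= /count_below tnth_mktuple -(card_imset _ (@perm_inj _ tau)).
  congr (is_true (_ <= _%:R)%R); apply: eq_card => i; rewrite inE.
  apply/imsetP/idP => [[i' + ->]|lt]; first by rewrite inE tnth_mktuple.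
  by exists (tau^-1%g i); rewrite ?inE ?tnth_mktuple permKV.
have EV k : E k =
    [set w | (x <= (count_below (fun i => S (V i w)) (S (V k w)))%:R)%R].
  apply/funext => w; rewrite /E /=; have := high_rankV 1%g k w.
  by rewrite (congr1 (@^~ w) (mktuple_perm1 V)) perm1.
have PE k : P (E k) = P (E j).
  rewrite -[RHS](exV (tperm j k))//; congr (P _); rewrite EV.
  by apply/funext => w; rewrite /= high_rankV tpermL.
have -> : m%:R%:E * P (E j) = \sum_(k < m) P (E k).
  have -> : m%:R%:E = \sum_(k < m) 1%:E :> \bar R.
    by rewrite sumEFin sumr_const card_ord.
  rewrite ge0_sume_distrl//; apply: eq_bigr => k _.
  by rewrite mul1e PE.
have -> : \sum_(k < m) P (E k) = \int[P]_w \sum_(k < m) (\1_(E k) w)%:E.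
  rewrite ge0_integral_sum//; last first.
    by move=> k; apply/measurable_EFinP; exact: measurable_indic.
  by apply: eq_bigr => k _; rewrite integral_indic// setIT.
rewrite -[leRHS]mule1 -(probability_setT P) -integral_cst//.
apply: ge0_le_integral => //.
- by move=> w _; apply: sume_ge0.
- apply: emeasurable_sum => k; apply/measurable_EFinP; exact: measurable_indic.
- move=> w _; rewrite sumEFin lee_fin.
  apply: le_trans (card_high_ranks (fun i => S (V i w)) xm).
  rewrite -sum1_card natr_sum [leRHS]big_mkcond /=.
  apply: ler_sum => k _; rewrite indicE EV inE.
  by case: (boolP (_ \in _)) => [/set_mem/= ->|_] //; case: ifP.
Qed.

End high_rank.

(** * Miscoverage of the latent law *)

Section average_miscoverage.
Context d d1 d2 (Omega : measurableType d) (T1 : measurableType d1)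
  (T2 : measurableType d2) (R : realType) (P : probability Omega R) (m : nat).
Variables (Z : 'I_m -> Omega -> T1) (Y : 'I_m -> Omega -> T2).
Variable q : T1 -> pprobability T2 R.
Hypothesis mZ : forall i, measurable_fun setT (Z i).
Hypothesis mY : forall i, measurable_fun setT (Y i).
Hypothesis mq : measurable_fun setT q.
Hypothesis exZ : exchangeable P Z.
Hypothesis YZ : cond_indep_laws P (fun w => [tuple Z i w | i < m]) Y
  (fun i z B => q (tnth z i) B).
Variables (S : T1 * T2 -> R) (j : 'I_m).
Hypothesis mS : measurable_fun setT S.

(** For the last instance and a level in (0, 1), this is the mass that the latent
    law gives to the complement of the conformal set, the set being written with
    ranks so that it makes sense for every real [gamma]. *)
Definition miscoverage (w : Omega) (gamma : R) : \bar R :=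
  q (Z j w) (resample Z Y j w @^-1` high_rank S (m%:R * (1 - gamma))%R j).

Let mmiss :
  measurable_fun setT (fun wg : Omega * R => (m%:R * (1 - wg.2))%R).
Proof.
apply: measurable_funM; first exact: measurable_cst.
by apply: measurable_funB => //; exact: measurable_snd.
Qed.

(** Joint measurability in the sample and the level is what Tonelli's theorem
    needs. Since the rank formulation is measurable in all variables together,
    the miscoverage is the mass of a section of a measurable set. *)
Lemma measurable_miscoverage :
  measurable_fun setT (fun wg : Omega * R => miscoverage wg.1 wg.2).
Proof.
have mqZ : measurable_fun setT (fun wg : Omega * R => q (Z j wg.1)).
  by apply: measurableT_comp => //; exact: measurableT_comp.
pose G : set ((Omega * R) * T2) := [set u |
  high_rank S (m%:R * (1 - u.1.2))%R j (resample Z Y j u.1.1 u.2)].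
have mG : measurable G.
  apply: measurable_high_rank => //; last exact: (measurableT_comp mmiss).
  apply: (measurableT_comp (measurable_resample mZ mY j)
    (g := fun u : Omega * R * T2 => (u.1.1, u.2))).
  apply: measurable_fun_pair => //.
  exact: (measurableT_comp (f := fst)).
have := measurable_fun_xsection_finite_kernel (kprobability mqZ) (mem_set mG).
apply: eq_measurable_fun => -[w gamma] _ /=.
by rewrite /miscoverage xsectionE.
Qed.

(** Redrawing the outcome identifies the average with the probability that
    instance [j] has a high rank, which is the usual conformal bound. *)
Lemma average_miscoverage gamma : (0 <= gamma)%R ->
  \int[P]_w miscoverage w gamma <= gamma%:E.
Proof.
move=> g0.
have m0 : (0 < m%:R :> R)%R by rewrite ltr0n; case: (m) j => // -[].
have mhr : measurable (high_rank S (m%:R * (1 - gamma))%R j).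
  by apply: (measurable_high_rank mS (t := id) (x := cst _)).
rewrite (resample_law mZ mY mq YZ)//.
have := @exchangeable_high_rank _ _ _ m S mS _ _ P (fun i w => (Z i w, Y i w))
  (m%:R * (1 - gamma))%R j.
move=> /(_ _ _ _)/wrap[].
- by move=> i; exact: measurable_fun_pair.
- exact: (exchangeable_outcomes mZ mY YZ).
- by rewrite ler_piMr ?ler0n// lerBlDr lerDl.
have -> : (m%:R - m%:R * (1 - gamma) = m%:R * gamma)%R.
  by rewrite mulrBr mulr1 opprB addrCA subrr addr0.
by rewrite EFinM lee_pmul2l.
Qed.

End average_miscoverage.

(** * The mixed e-value *)

Section average_evalue.
Context d (Omega : measurableType d) (R : realType) (P : probability Omega R)
  (nu : probability R R) (Gamma : set R) (mis : Omega -> R -> \bar R).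
Hypothesis mGamma : measurable Gamma.
Hypothesis Gamma_gt0 : forall gamma, Gamma gamma -> (0 < gamma)%R.
Hypothesis mis_ge0 : forall w gamma, 0 <= mis w gamma.
Hypothesis mmis :
  measurable_fun setT (fun wg : Omega * R => mis wg.1 wg.2).

Let evalue w := \int[nu]_(gamma in Gamma) (mis w gamma * (gamma^-1)%:E).

(* Restricting 1 / gamma to Gamma keeps it nonnegative on the whole line. *)
Let weight : R -> \bar R := (fun gamma => (gamma^-1)%:E) \_ Gamma.

Let weight_ge0 gamma : 0 <= weight gamma.
Proof.
rewrite /weight patchE; case: ifPn => // /set_mem /Gamma_gt0 g0.
by rewrite lee_fin invr_ge0 ltW.
Qed.

Let mweight : measurable_fun setT weight.
Proof.
have [+ _] := measurable_restrictT (fun gamma : R => (gamma^-1)%:E) mGamma.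
apply; apply/measurable_EFinP.
apply: (@measurable_funS _ _ R R `]0%R, +oo[%classic) => //.
  by move=> g /Gamma_gt0 g0; rewrite /= in_itv /= g0.
apply: open_continuous_measurable_fun; first exact: interval_open.
move=> g /set_mem; rewrite /= in_itv /= andbT => g0.
by apply: inv_continuous; rewrite gt_eqF.
Qed.

Let integrand (wg : Omega * R) := mis wg.1 wg.2 * weight wg.2.

Let mintegrand : measurable_fun setT integrand.
Proof.
apply: emeasurable_funM => //.
exact: (measurableT_comp mweight).
Qed.

Let integrand_ge0 wg : 0 <= integrand wg.
Proof. exact: mule_ge0. Qed.

Let evalueE w : evalue w = \int[nu]_gamma integrand (w, gamma).
Proof.
rewrite /evalue integral_mkcond; apply: eq_integral => g _.
by rewrite /integrand /weight /= !patchE; case: ifP => //; rewrite mule0.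
Qed.

Lemma measurable_evalue : measurable_fun setT evalue.
Proof.
have -> : evalue = fubini_F nu integrand by apply/funext => w; exact: evalueE.
exact: measurable_fun_fubini_tonelli_F.
Qed.

(** The factor 1 / gamma cancels the bound gamma on the average miscoverage, so
    the integrand over the levels is at most one once Tonelli's theorem has
    exchanged the integrals. *)
Lemma average_evalue :
  (forall gamma, Gamma gamma -> \int[P]_w mis w gamma <= gamma%:E) ->
  \int[P]_w evalue w <= 1.
Proof.
move=> mis_le.
under eq_integral do rewrite evalueE.
rewrite (fubini_tonelli integrand)//.
apply: (@le_trans _ _ (\int[nu]_gamma cst 1 gamma)); last first.
  by rewrite integral_cst// mul1e; exact: (probability_le1 nu).
apply: ge0_le_integral => //.
- by move=> g _; exact: integral_ge0.
- exact: (measurable_fun_fubini_tonelli_G integrand).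
move=> g _; rewrite /integrand /=.
rewrite ge0_integralZr//; last exact: (measurableT_comp mmis (pair2_measurable g)).
rewrite /weight patchE; case: ifPn => [/set_mem Gg|_]; last by rewrite mule0.
have g0 := Gamma_gt0 Gg.
apply: (@le_trans _ _ (g%:E * (g^-1)%:E)).
  by rewrite lee_wpmul2r ?mis_le// lee_fin invr_ge0 ltW.
by rewrite -EFinM divff ?gt_eqF.
Qed.

End average_evalue.

Lemma markov_threshold d (Omega : measurableType d) (R : realType)
    (P : probability Omega R) (e : Omega -> \bar R) (alpha : R) :
  measurable_fun setT e -> (forall w, 0 <= e w) -> \int[P]_w e w <= 1 ->
  (0 < alpha)%R ->
  (1 - alpha)%:E <= P [set w | e w <= (alpha^-1)%:E].
Proof.
move=> me e0 e1 a0.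
have mA : measurable [set w | (alpha^-1)%:E < e w].
  rewrite -[X in measurable X]setTI; exact: emeasurable_fun_o_infty.
have mB : measurable [set w | (alpha^-1)%:E <= `|e w|].
  rewrite -[X in measurable X]setTI; apply: emeasurable_fun_c_infty => //.
  exact: measurableT_comp.
have -> : [set w | e w <= (alpha^-1)%:E] = ~` [set w | (alpha^-1)%:E < e w].
  by apply/seteqP; split => w /=; rewrite leNgt => /negP.
rewrite probability_setC// EFinB leeB//.
have ai0 : (0 < alpha^-1)%R by rewrite invr_gt0.
have markov : (alpha^-1)%:E * P [set w | (alpha^-1)%:E <= `|e w|] <= 1.
  apply: le_trans e1; rewrite -[X in P X]setTI.
  rewrite (eq_integral (fun w => `|e w|)); last first.
    by move=> w _; rewrite gee0_abs.
  by apply: (@le_integral_comp_abse _ _ _ P _ measurableT e _ id).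
apply: (@le_trans _ _ (P [set w | (alpha^-1)%:E <= `|e w|])).
  apply: le_measure; rewrite ?inE// => w /= /ltW.
  by rewrite gee0_abs.
by rewrite -(@lee_pmul2l _ (alpha^-1)%:E)// -EFinM mulVf// gt_eqF.
Qed.

Theorem theorem1 (R : realType)
    (dO dX dY : measure_display)
    (Omega : measurableType dO) (XT : measurableType dX)
    (YT : measurableType dY)
    (XT_std : standard_borel R XT) (YT_std : standard_borel R YT)
    (P : probability Omega R) (n : nat)
    (X : 'I_n.+1 -> {RV P >-> XT})
    (Q : 'I_n.+1 -> {RV P >-> pprobability YT R})
    (Y : 'I_n.+1 -> {RV P >-> YT})
    (mixing : R.-pker XT ~> pprobability YT R)
    (Q_given_X : forall i : 'I_n.+1,
       cond_law P (X i) (Q i) (fun x B => mixing x B))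
    (Y_given_XQ : forall i : 'I_n.+1,
       cond_law P (fun w => (X i w, Q i w)) (Y i) (fun z B => z.2 B))
    (latent_exchangeable :
       exchangeable P (fun (i : 'I_n.+1) w => (X i w, Q i w)))
    (outcomes_given_latent :
       cond_indep_laws P (fun w => [tuple (X i w, Q i w) | i < n.+1])
         (fun i : 'I_n.+1 => Y i : Omega -> YT)
         (fun i z B => (tnth z i).2 B))
    (s : XT * YT -> R) (s_meas : measurable_fun [set: XT * YT] s)
    (alpha : R) (alpha_gt0 : (0 < alpha)%R) (alpha_lt1 : (alpha < 1)%R)
    (Gamma : set R) (Gamma_meas : measurable Gamma)
    (Gamma_sub : forall gamma : R, Gamma gamma -> (0 < gamma < alpha)%R)
    (nu : probability R R) (nu_Gamma : nu Gamma = 1) :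
  let calib (w : Omega) (i : 'I_n) : XT * YT :=
    (X (widen_ord (leqnSn n) i) w, Y (widen_ord (leqnSn n) i) w) in
  (1 - alpha)%:E <=
    P [set w | ambiguity_set s (calib w) Gamma nu alpha (X ord_max w)
                 (Q ord_max w)].
Proof.
pose calib w (i : 'I_n) :=
  (X (widen_ord (leqnSn n) i) w, Y (widen_ord (leqnSn n) i) w).
change ((1 - alpha)%:E <= P [set w | mixed_evalue s (calib w) Gamma nu
  (Q ord_max w) (X ord_max w) <= (alpha^-1)%:E]).
pose Z (i : 'I_n.+1) w := (X i w, Q i w).
have mX i : measurable_fun setT (X i) by exact: measurable_funPT.
have mQ i : measurable_fun setT (Q i) by exact: measurable_funPT.
have mY i : measurable_fun setT (Y i) by exact: measurable_funPT.
have mZ i : measurable_fun setT (Z i) by exact: measurable_fun_pair.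
have mq : measurable_fun setT (snd : XT * pprobability YT R -> _).
  exact: measurable_snd.
pose S (t : (XT * pprobability YT R) * YT) := s (t.1.1, t.2).
have mS : measurable_fun setT S.
  apply: measurableT_comp => //; apply: measurable_fun_pair => //.
  exact: (measurableT_comp (f := fst)).
pose mis := miscoverage Z Y snd S ord_max.
have Gamma01 gamma : Gamma gamma -> (0 < gamma < 1)%R.
  by move=> /Gamma_sub /andP[-> /lt_trans]; exact.
have mmis := measurable_miscoverage mZ mY mq ord_max mS.
have conformal_setCE w gamma : Gamma gamma ->
    ~` conformal_set s (calib w) gamma (X ord_max w) =
    resample Z Y ord_max w @^-1`
      high_rank S (n.+1%:R * (1 - gamma))%R ord_max.
  move=> /Gamma01 g01; rewrite conformal_setC//.
  apply/funext => y; rewrite /high_rank /= !count_belowE big_ord_recr /=.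
  (* The candidate is not strictly below itself, so counting among all n + 1
     instances equals counting among the calibration instances. *)
  rewrite /S !tnth_mktuple /= eqxx ltxx addr0.
  congr (is_true (_ <= _)%R); apply: eq_bigr => i _.
  by rewrite tnth_mktuple /= -val_eqE /= ltn_eqF.
have mconformal w gamma : Gamma gamma ->
    measurable (conformal_set s (calib w) gamma (X ord_max w)).
  move=> Gg; rewrite -[X in measurable X]setCK; apply: measurableC.
  rewrite conformal_setCE//.
  apply: (measurable_high_rank mS (x := cst _)) => //.
  exact: measurableT_comp (measurable_resample mZ mY ord_max)
    (pair1_measurable w).
have evalueE w : mixed_evalue s (calib w) Gamma nu (Q ord_max w) (X ord_max w) =
    \int[nu]_(gamma in Gamma) (mis w gamma * (gamma^-1)%:E).
  apply: eq_integral => gamma /set_mem Gg; rewrite /miscoverage_ratio.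
  by rewrite -probability_setC ?conformal_setCE//; exact: mconformal.
under eq_set do rewrite evalueE.
have Gamma_gt0 gamma : Gamma gamma -> (0 < gamma)%R.
  by move=> /Gamma01 /andP[].
apply: markov_threshold => //.
- exact: measurable_evalue.
- move=> w; apply: integral_ge0 => gamma /Gamma_gt0 g0.
  by rewrite mule_ge0// lee_fin invr_ge0 ltW.
- apply: average_evalue => // gamma /Gamma_gt0 g0.
  exact: average_miscoverage (ltW g0).
Qed.
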